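(* Let $\lambda$ be a nonzero real number and $r\ge0$ an integer. For all integers $n,k\ge 0$, $$L^{r}_{\lambda}(n,k)=\frac{n!}{k!}\binom{r+\lambda(n-1)}{n-k}_{\lambda}.$$
   Context: For nonzero real $\lambda$, the degenerate falling and rising factorials are $(x)_{0,\lambda}=1$, $(x)_{n,\lambda}=x(x-\lambda)\cdots(x-(n-1)\lambda)$ and $\langle x\rangle_{0,\lambda}=1$, $\langle x\rangle_{n,\lambda}=x(x+\lambda)\cdots(x+(n-1)\lambda)$ for $n\ge1$. The $\lambda$-analogues of the $r$-Lah numbers, $L_\lambda^r(n,k)$ ($0\le k\le n$), are defined by the polynomial identity $\langle x+r\rangle_{n,\lambda}=\sum_{k=0}^n L_\lambda^r(n,k)(x)_{k,\lambda}$ for $n\ge0$; $L_\lambda^r(n,k)=0$ for $k>n$. The degenerate binomial coefficients are $\binom{x}{0}_\lambda=1$, $\binom{x}{n}_\lambda=\frac{(x)_{n,\lambda}}{n!}$ for $n\ge1$, and $\binom{x}{n}_\lambda=0$ for $n<0$. *)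

(* Defs.v *)
From mathcomp Require Import all_boot all_order all_algebra.
From mathcomp Require Import reals.

Set Implicit Arguments.
Unset Strict Implicit.
Unset Printing Implicit Defensive.

Import GRing.Theory.
Local Open Scope ring_scope.

(* The factorials are defined over an arbitrary commutative ring so that they *)
(* apply both to real numbers and to polynomials.                             *)
Definition dfalling (A : comNzRingType) (lam x : A) (n : nat) : A :=
  \prod_(i < n) (x - i%:R * lam).

Definition drising (A : comNzRingType) (lam x : A) (n : nat) : A :=
  \prod_(i < n) (x + i%:R * lam).

Definition dbinom (F : fieldType) (lam x : F) (m : int) : F :=
  match m with
  | Posz n => dfalling lam x n / n`!%:R
  | Negz _ => 0
  end.

(* c is the n-th row of the lambda-analogues of the r-Lah numbers; the        *)
(* variable x of the defining identity is the indeterminate of {poly R}.      *)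
Definition is_rlah_row (R : comNzRingType) (lam : R) (r n : nat)
    (c : nat -> R) : Prop :=
  drising lam%:P ('X + r%:R%:P) n
    = \sum_(k < n.+1) c k *: dfalling lam%:P 'X k
  /\ forall k, (n < k)%N -> c k = 0.

Section RLah.
Variables (R : comNzRingType) (lam : R).

Lemma dfallingXE k :
  dfalling lam%:P 'X k = \prod_(i < k) ('X - (i%:R * lam)%:P).
Proof. by apply: eq_bigr => i _; rewrite rmorphM rmorph_nat. Qed.

Lemma size_dfallingX k : size (dfalling lam%:P 'X k) = k.+1.
Proof. by rewrite dfallingXE size_prod_XsubC /index_enum -enumT size_enum_ord. Qed.

Lemma coef_dfallingX_top k : (dfalling lam%:P 'X k)`_k = 1.
Proof.
have /monicP := monic_prod_XsubC (index_enum 'I_k) xpredT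
  (fun i : 'I_k => i%:R * lam).
by rewrite -dfallingXE lead_coefE size_dfallingX.
Qed.

Lemma size_sum_dfallingX n (c : nat -> R) :
  (size (\sum_(k < n) c k *: dfalling lam%:P 'X k)%R <= n)%N.
Proof.
apply: (leq_trans (size_sum _ _ _)); apply/bigmax_leqP => i _.
by apply: (leq_trans (size_scale_leq _ _)); rewrite size_dfallingX.
Qed.

Lemma coef_sum_dfallingX_top n (c : nat -> R) :
  (\sum_(k < n.+1) c k *: dfalling lam%:P 'X k)`_n = c n.
Proof.
rewrite big_ord_recr /= coefD coefZ coef_dfallingX_top mulr1.
by rewrite nth_default ?add0r ?size_sum_dfallingX.
Qed.

Lemma dfallingX_span n (p : {poly R}) : (size p <= n)%N ->
  {c : nat -> R | p = \sum_(k < n) c k *: dfalling lam%:P 'X k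
                  /\ forall k, (n <= k)%N -> c k = 0}.
Proof.
elim: n p => [|n IHn] p sp.
  exists (fun=> 0); split=> //.
  by rewrite big_ord0; apply/eqP; rewrite -size_poly_eq0 -leqn0.
have [|c [def_p c0]] := IHn (p - p`_n *: dfalling lam%:P 'X n).
  apply/leq_sizeP => j; rewrite leq_eqVlt => /predU1P[<-|ltnj].
    by rewrite coefB coefZ coef_dfallingX_top mulr1 subrr.
  rewrite coefB coefZ (nth_default _ (leq_trans sp ltnj)).
  by rewrite [X in _ * X]nth_default ?size_dfallingX ?mulr0 ?subrr.
exists (fun k => if k == n then p`_n else c k); split=> [|k ltnk]; last first.
  by rewrite gtn_eqF // c0 // ltnW.
rewrite big_ord_recr /= eqxx; apply/eqP; rewrite -subr_eq def_p; apply/eqP.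
by apply: eq_bigr => i _; rewrite ltn_eqF.
Qed.

Lemma dfallingX_free n (c d : nat -> R) :
  \sum_(k < n) c k *: dfalling lam%:P 'X k
    = \sum_(k < n) d k *: dfalling lam%:P 'X k ->
  forall k, (k < n)%N -> c k = d k.
Proof.
elim: n => // n IHn eq_cd.
have eq_n : c n = d n.
  by rewrite -(coef_sum_dfallingX_top n c) eq_cd coef_sum_dfallingX_top.
move=> k; rewrite ltnS leq_eqVlt => /predU1P[->//|]; apply: IHn.
by move: eq_cd; rewrite !big_ord_recr /= eq_n => /addIr.
Qed.

Lemma size_drisingX r n :
  (size (drising lam%:P ('X + r%:R%:P)%R n) <= n.+1)%N.
Proof.
rewrite /drising (eq_bigr (fun i : 'I_n => 'X - (- (r%:R + i%:R * lam))%:P)).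
  by rewrite size_prod_XsubC /index_enum -enumT size_enum_ord.
by move=> i _; rewrite polyCN opprK polyCD polyCM [X in _ * X]/= addrA !polyC_natr.
Qed.

Lemma rlah_row_exists r n : {c : nat -> R | is_rlah_row lam r n c}.
Proof. exact: dfallingX_span (size_drisingX r n). Qed.

(* Nothing is known about rlah beyond its defining identity rlahP, which      *)
(* determines it by rlah_unique.                                              *)
Definition rlah (r n k : nat) : R := sval (rlah_row_exists r n) k.

Lemma rlahP r n : is_rlah_row lam r n (rlah r n).
Proof. exact: svalP (rlah_row_exists r n). Qed.

Lemma rlah_unique r n (c : nat -> R) :
  is_rlah_row lam r n c -> forall k, c k = rlah r n k.
Proof.
have [eL L0] := rlahP r n; case=> eC c0 k.
have [ltnk|lekn] := ltnP n k; first by rewrite c0 ?L0.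
by apply: (@dfallingX_free n.+1) => //; rewrite -eL -eC.
Qed.

End RLah.

(* Main.v *)
(* The rising factorial [<x + r>_n] is the falling factorial                  *)
(* [(x + (r + lam (n - 1)))_n] read backwards; expanding the latter by the    *)
(* Chu-Vandermonde identity for degenerate falling factorials yields a row of *)
(* coefficients, which are the Lah numbers by uniqueness.                     *)
Require Import Defs.
From mathcomp Require Import all_boot all_order all_algebra.
From mathcomp Require Import reals.
From mathcomp Require Import ring.

Import GRing.Theory Num.Theory.
Local Open Scope ring_scope.

(** [drisingE] and [dfallingD] yield the row in [rlahE] with no division, over any commutative ring.
    Over a field, ['C(n, k) = n! / (k! (n - k)!)] then moves [(n - k)!] into the degenerate
    binomial. *)

Lemma dfallingS (A : comNzRingType) (lam x : A) (n : nat) :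
  dfalling lam x n.+1 = dfalling lam x n * (x - n%:R * lam).
Proof. by rewrite /dfalling big_ord_recr. Qed.

Lemma dfallingD (A : comNzRingType) (lam x y : A) (n : nat) :
  dfalling lam (x + y) n
    = \sum_(k < n.+1) (dfalling lam x k * dfalling lam y (n - k)) *+ 'C(n, k).
Proof.
elim: n => [|n IHn].
  by rewrite big_ord_recl !big_ord0 /dfalling !big_ord0 mulr1 addr0.
(* [a] and [b] collect the terms in which the new factor extends the [x] part or the [y] part;
   Pascal's rule merges them after a shift of index. *)
pose a k := (dfalling lam x k.+1 * dfalling lam y (n - k)) *+ 'C(n, k).
pose b k := (dfalling lam x k * dfalling lam y (n.+1 - k)) *+ 'C(n, k).
transitivity (\sum_(k < n.+1) a k + \sum_(k < n.+1) b k).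
  rewrite dfallingS IHn big_distrl -big_split; apply: eq_bigr => k _ /=.
  have lekn : (k <= n)%N by rewrite -ltnS.
  (* The new factor is [(x - k lam) + (y - (n - k) lam)]. *)
  rewrite /a /b subSn // (dfallingS _ lam x) (dfallingS _ lam y) natrB //.
  by move: (dfalling lam x k) (dfalling lam y (n - k)) => u v; ring.
have -> : \sum_(k < n.+1) b k = \sum_(k < n.+2) b k.
  by rewrite [RHS]big_ord_recr /= /b bin_small // mulr0n addr0.
rewrite 2![in \sum_(k < n.+2) _]big_ord_recl addrCA -big_split.
congr (_ + _); first by rewrite /b !bin0.
by apply: eq_bigr => k _; rewrite /= /a /b /bump add1n subSS binS mulrnDr addrC.
Qed.

(** The substitution [i -> n - 1 - i] reverses the order of the factors. *)
Lemma drisingE (A : comNzRingType) (lam x : A) (n : nat) :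
  drising lam x n = dfalling lam (x + lam * (n%:R - 1)) n.
Proof.
rewrite /drising (reindex_inj rev_ord_inj); apply: eq_bigr => i _ /=.
by rewrite natrB // -natr1; ring.
Qed.

Lemma dfalling_polyC (A : comNzRingType) (lam x : A) (n : nat) :
  dfalling lam%:P x%:P n = (dfalling lam x n)%:P.
Proof.
by rewrite rmorph_prod; apply: eq_bigr => i _; rewrite rmorphB rmorphM rmorph_nat.
Qed.

Lemma rlahE (A : comNzRingType) (lam : A) (r n k : nat) :
  rlah lam r n k = dfalling lam (r%:R + lam * (n%:R - 1)) (n - k) *+ 'C(n, k).
Proof.
symmetry; move: k.
apply: (rlah_unique (c := fun k => dfalling _ _ (n - k) *+ 'C(n, k))).
split=> [|k ltnk]; last by rewrite bin_small.
have yE : r%:R%:P + lam%:P * (n%:R - 1) = (r%:R + lam * (n%:R - 1))%:P.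
  by rewrite polyCD polyCM polyCB polyC1 !polyC_natr.
rewrite drisingE -addrA yE dfallingD; apply: eq_bigr => k _.
by rewrite dfalling_polyC mulrC mul_polyC scalerMnl.
Qed.

Theorem theorem3p2 (R : realType) (lam : R) (r : nat) (lam_neq0 : lam != 0)
    (n k : nat) :
  rlah lam r n k
    = n`!%:R / k`!%:R * dbinom lam (r%:R + lam * (n%:R - 1)) (n%:Z - k%:Z).
Proof.
have fact_neq0 m : m`!%:R != 0 :> R by rewrite pnatr_eq0 -lt0n fact_gt0.
rewrite rlahE; have [lekn|ltnk] := leqP k n.
  rewrite subzn //= -(bin_fact lekn) !natrM -mulr_natr.
  by field; rewrite !fact_neq0.
(* [Negz m] is [- (m + 1)], hence the predecessor; [dbinom] is 0 there, as is ['C(n, k)]. *)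
have -> : n%:Z - k%:Z = Negz (k - n).-1.
  by rewrite NegzE prednK ?subn_gt0 // -subzn ?opprB // ltnW.
by rewrite bin_small // mulr0n mulr0.
Qed.
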